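(* Let $\mathcal{P}\subseteq\mathbb{R}^D$ have linear span equal to $\mathbb{R}^D$, $\mathcal{U}=\mathcal{P}\times\mathbb{R}^m$, and let $f:\mathcal{U}^+\to\mathbb{R}^r$ be an input-output map. Then $f$ has a realization by an ALPV if and only if $f$ has a GCR and its Hankel-matrix satisfies $\mathrm{rank}\,H_f<+\infty$. Any minimal ALPV realization of $f$ has dimension equal to $\mathrm{rank}\,H_f$.
   Context: Fix positive integers $D,m,r$, put $Q=\{1,\dots,D\}$. For a set $X$, $X^+$ denotes the set of finite non-empty sequences of elements of $X$, $X^*=X^+\cup\{\epsilon\}$ with $\epsilon$ the empty sequence, $|v|$ is the length of $v$ ($|\epsilon|=0$), and $vw$ denotes concatenation. $\mathbb{N}$ contains $0$. ALPV. For $\mathcal{P}\subseteq\mathbb{R}^D$ (scheduling space), a discrete-time affine LPV system (ALPV) $\Sigma=(r,m,n,\mathcal{P},\{(A_q,B_q,C_q)\}_{q=1}^D)$ consists of $n\in\mathbb{N}$ and matrices $A_q\in\mathbb{R}^{n\times n}$, $B_q\in\mathbb{R}^{n\times m}$, $C_q\in\mathbb{R}^{r\times n}$, $q\in Q$, and has dynamics $$x(t+1)=\sum_{q=1}^D (A_qx(t)+B_qu(t))p_q(t),\qquad y(t)=\sum_{q=1}^D C_qx(t)p_q(t),$$ with $p(t)=(p_1(t),\dots,p_D(t))\in\mathcal{P}$, $u(t)\in\mathbb{R}^m$. Its dimension is $\dim\Sigma=n$. Its input-output map $y_\Sigma:\mathcal{U}^+\to\mathbb{R}^r$ sends $w=(p(0),u(0))\cdots(p(t),u(t))$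 to the output $y(t)$ at time $t$ when $x(0)=0$ and the scheduling values and inputs in $w$ are applied. $\Sigma$ is a realization of $f$ if $f=y_\Sigma$; it is a minimal realization of $f$ if moreover $\dim\Sigma\le\dim\hat\Sigma$ for every ALPV realization $\hat\Sigma$ of $f$ (same $r,m,\mathcal{P}$). GCR. $f$ has a generalized convolution representation (GCR) if there is a map $S^f:\{v\in Q^+:|v|>1\}\to\mathbb{R}^{r\times m}$ such that for every $w=(p(0),u(0))\cdots(p(t),u(t))\in\mathcal{U}^+$ $$f(w)=\sum_{k=0}^{t-1}\Big\{\sum_{v\in Q^+,|v|=t-k+1}S^f(v)\,\underline{p}_{k:t}^{v}\Big\}u(k),$$ where for $v=q_0\cdots q_{t-k}$, $\underline{p}_{k:t}^{v}=p_{q_0}(k)p_{q_1}(k+1)\cdots p_{q_{t-k}}(t)$. When $\mathcal{P}$ spans $\mathbb{R}^D$, $S^f$ is uniquely determined by $f$. Markov-parameters and Hankel-matrix (for $f$ with a GCR). For $v\in Q^*$, $M^f(v)$ is the $rD\times mD$ matrix viewed as a $D\times D$ block matrix whose $(i,j)$ block is $S^f(jvi)\in\mathbb{R}^{r\times m}$, $i,j\in Q$. Order $Q^*$ by: $v\prec s$ if $|v|<|s|$, or $|v|=|s|>0$, $v\neq s$ and at the first position where $v$ and $s$ differ the entry of $v$ is smaller; enumerate $Q^*=\{v_1,v_2,\dots\}$ with $v_1\prec v_2\prec\cdots$ (so $v_1=\epsilon$). $H_f$ is the infinite block matrix whose block in block row $i$ and block column $j$ ($i,j=1,2,\dots$)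 is $M^f(v_jv_i)$. Its rank is the dimension of the linear span of its columns (possibly $+\infty$). *)

(* Defs.v *)
From HB Require Import structures.
From mathcomp Require Import all_boot all_order all_algebra.
From mathcomp Require Import all_classical all_reals.

Set Implicit Arguments.
Unset Strict Implicit.
Unset Printing Implicit Defensive.

Import Order.TTheory GRing.Theory Num.Theory.
Local Open Scope classical_set_scope.
Local Open Scope ring_scope.

(* X^+: a sequence is stored with its length t.+1, so that its entries are
   indexed by the times 0, ..., t. *)
Definition nonempty_seq (X : Type) := {t : nat & t.+1.-tuple X}.

Section LinearSpan.
Context {R : realType} {V : lmodType R}.

Definition lin_span (S : set V) : set V :=
  [set x | exists n (a : 'I_n -> R) (v : 'I_n -> V),
             (forall i, S (v i)) /\ x = \sum_i a i *: v i].

Definition lin_indep n (e : 'I_n -> V) :=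
  forall a : 'I_n -> R, \sum_i a i *: e i = 0 -> forall i, a i = 0.

Definition is_basis (W : set V) n (e : 'I_n -> V) :=
  lin_indep e /\ lin_span (range e) = W.

(* The dimension of the subspace W, with value +oo when W has no finite
   basis. *)
Definition lin_dim (W : set V) : \bar R :=
  match pselect (exists n, exists e : 'I_n -> V, is_basis W e) with
  | left h => (projT1 (cid h))%:R%:E
  | right _ => +oo%E
  end.

End LinearSpan.

(* The rank of a possibly infinite matrix is the dimension of the span of its
   columns, a column being a function of the row index. *)
Definition mat_rank {R : realType} (I J : Type) (H : I -> J -> R) : \bar R :=
  lin_dim (lin_span (range (fun j : J => (fun i : I => H i j) : I -> R^o))).

Section Words.
Context {D : nat}.
Local Open Scope nat_scope.

(* The order on Q^*; the letters 1, ..., D are represented by 'I_D. *)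
Definition word_lt (v s : seq 'I_D) : Prop :=
  size v < size s \/
  size v = size s /\
    exists (u : seq 'I_D) (a b : 'I_D) (v' s' : seq 'I_D),
      [/\ v = u ++ a :: v', s = u ++ b :: s' & a < b].

Fixpoint words_of_size (l : nat) : seq (seq 'I_D) :=
  if l is l'.+1 then [seq q :: w | q <- enum 'I_D, w <- words_of_size l']
  else [:: [::]].

Definition words_upto (k : nat) : seq (seq 'I_D) :=
  flatten [seq words_of_size l | l <- iota 0 k.+1].

(* The increasing enumeration of Q^*, starting at index 0 with the empty word:
   for 0 < D at least k.+1 words have length at most k.  See [word_mono] and
   [word_onto]. *)
Definition word (k : nat) : seq 'I_D := nth [::] (words_upto k) k.

Let ltb v s := `[< word_lt v s >].

Lemma pairwise_flatten_map (I X : Type) (e : rel I) (r : rel X)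
    (f : I -> seq X) (s : seq I) :
  pairwise e s -> (forall i, pairwise r (f i)) ->
  (forall i j, e i j -> allrel r (f i) (f j)) ->
  pairwise r (flatten [seq f i | i <- s]).
Proof.
move=> + fr ef; elim: s => [//|i s IHs] /= /andP[es ps].
rewrite pairwise_cat fr IHs// andbT andbT.
elim: s es {ps IHs} => [|j s IHs] /=; first by rewrite allrel0r.
by move=> /andP[ij es]; rewrite allrel_catr ef// IHs.
Qed.

Lemma size_mem_words l w : w \in words_of_size l = (size w == l).
Proof.
elim: l w => [|l IHl] w /=; first by rewrite inE size_eq0.
apply/allpairsP/idP => [[[q v] /= [_]]|].
  by rewrite IHl => /eqP <- ->.
case: w => [//|q w]; rewrite /= eqSS -IHl => wl.
by exists (q, w); rewrite /= mem_enum.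
Qed.

Lemma pairwise_words l : pairwise ltb (words_of_size l).
Proof.
elim: l => [//|l IHl] /=.
apply: (@pairwise_flatten_map _ _ (fun i j : 'I_D => i < j)).
- by rewrite -(pairwise_map val ltn) val_enum_ord -sorted_pairwise;
    [exact: iota_ltn_sorted|exact: ltn_trans].
- move=> i; rewrite pairwise_map; apply: sub_pairwise IHl => v s.
  move=> /asboolP[vs|[vs [u [a [b [v' [s' [ev es ab]]]]]]]]; apply/asboolP.
    by left.
  right; split; first by rewrite /= vs.
  by exists (i :: u), a, b, v', s'; rewrite ev es.
- move=> i j ij; apply/allrelP => x y /mapP[v vl ->] /mapP[s sl ->].
  apply/asboolP; right; split; last by exists [::], i, j, v, s.
  by move: vl sl; rewrite !size_mem_words /= => /eqP -> /eqP ->.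
Qed.

Lemma pairwise_words_upto k : pairwise ltb (words_upto k).
Proof.
apply: (@pairwise_flatten_map _ _ ltn).
- by rewrite -sorted_pairwise; [exact: iota_ltn_sorted|exact: ltn_trans].
- exact: pairwise_words.
- move=> i j ij; apply/allrelP => v s; rewrite !size_mem_words.
  by move=> /eqP vi /eqP sj; apply/asboolP; left; rewrite vi sj.
Qed.

Lemma words_uptoD k i : exists s, words_upto (k + i) = words_upto k ++ s.
Proof.
by rewrite /words_upto -addSn iotaD map_cat flatten_cat; eexists.
Qed.

Context (D_gt0 : 0 < D).

Lemma size_words_upto k : k < size (words_upto k).
Proof.
have words_gt0 l : 0 < size (words_of_size l).
  have := size_mem_words l (nseq l (Ordinal D_gt0)).
  by rewrite size_nseq eqxx; case: (words_of_size l).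
elim: k => [//|k IHk]; rewrite /words_upto -addn1 iotaD map_cat flatten_cat.
rewrite size_cat -/(words_upto k) add0n [iota _ 1]/= [map _ [:: _]]/=.
rewrite [flatten [:: _]]/= cats0 !addn1 -[k.+2]addn1.
exact: leq_add IHk (words_gt0 k.+1).
Qed.

Lemma wordE k i : k <= i -> word k = nth [::] (words_upto i) k.
Proof.
move=> /subnKC <-; have [s ->] := words_uptoD k (i - k).
by rewrite nth_cat size_words_upto.
Qed.

Lemma word_mono i j : i < j -> word_lt (word i) (word j).
Proof.
move=> ij; rewrite (wordE (ltnW ij)) /word; apply/asboolP.
have /(pairwiseP [::]) := pairwise_words_upto j; apply=> //.
  by rewrite inE (ltn_trans ij)// size_words_upto.
by rewrite inE size_words_upto.
Qed.

Lemma word_onto v : exists k, word k = v.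
Proof.
have vP : v \in words_upto (size v).
  apply/flattenP; exists (words_of_size (size v)).
    by apply: map_f; rewrite mem_iota leq0n ltnSn.
  by rewrite size_mem_words.
exists (index v (words_upto (size v))).
set k := index _ _; have [kv|vk] := leqP k (size v).
  by rewrite (wordE kv) nth_index.
rewrite /word; have [s] := words_uptoD (size v) (k - size v).
by rewrite subnKC ?(ltnW vk)// => ->; rewrite nth_cat index_mem vP nth_index.
Qed.

End Words.

Section ALPV.
Context {R : realType}.

(* Points of the scheduling space are column vectors; the p in P x R^m ranges
   over the type of the elements of P. *)
Record alpv (D m r : nat) (P : set 'cV[R]_D) := ALPV {
  alpv_dim : nat;
  mxA : 'I_D -> 'M[R]_alpv_dim;
  mxB : 'I_D -> 'M[R]_(alpv_dim, m);
  mxC : 'I_D -> 'M[R]_(r, alpv_dim)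
}.

Context {D m r : nat} {P : set 'cV[R]_D}.

Definition next_state (Sigma : alpv m r P) (x : 'cV[R]_(alpv_dim Sigma))
    (pu : P * 'cV[R]_m) : 'cV[R]_(alpv_dim Sigma) :=
  \sum_(q < D) val pu.1 q 0 *: (mxA Sigma q *m x + mxB Sigma q *m pu.2).

Definition output (Sigma : alpv m r P) (x : 'cV[R]_(alpv_dim Sigma)) (p : P) :
    'cV[R]_r :=
  \sum_(q < D) val p q 0 *: (mxC Sigma q *m x).

Definition state (Sigma : alpv m r P) (w : seq (P * 'cV[R]_m)) :
    'cV[R]_(alpv_dim Sigma) :=
  foldl (@next_state Sigma) 0 w.

(* The output at time t depends on u(0), ..., u(t - 1) only, through x(t). *)
Definition io_map (Sigma : alpv m r P) :
    nonempty_seq (P * 'cV[R]_m) -> 'cV[R]_r :=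
  fun '(existT t w) => output (state Sigma (take t w)) (tnth w ord_max).1.

Implicit Type f : nonempty_seq (P * 'cV[R]_m) -> 'cV[R]_r.

Definition is_realization (Sigma : alpv m r P) f := f = io_map Sigma.

Definition is_minimal_realization (Sigma : alpv m r P) f :=
  is_realization Sigma f /\
  forall Sigma' : alpv m r P, is_realization Sigma' f ->
    (alpv_dim Sigma <= alpv_dim Sigma')%N.

(* p_{q_0}(k) p_{q_1}(k + 1) ... p_{q_{t - k}}(t) for v = q_0 ... q_{t - k}:
   the times k + i are at most t. *)
Definition sched_prod t (w : t.+1.-tuple (P * 'cV[R]_m)) (k : nat)
    (v : (t - k).+1.-tuple 'I_D) : R :=
  \prod_(i < (t - k).+1) val (tnth w (inord (k + i))).1 (tnth v i) 0.

(* S is defined on all words, but only its values on the words of length > 1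
   matter, here and in [markov] below. *)
Definition is_GCR f (S : seq 'I_D -> 'M[R]_(r, m)) :=
  forall t (w : t.+1.-tuple (P * 'cV[R]_m)),
    f (existT _ t w) =
    \sum_(k < t)
      (\sum_(v : (t - k).+1.-tuple 'I_D) sched_prod w v *: S v) *m
      (tnth w (inord k)).2.

Definition has_GCR f := exists S, is_GCR f S.

(* S^f; its values on the words of length > 1 are determined by f when f has a
   GCR and P spans. *)
Definition gcr_coef f : seq 'I_D -> 'M[R]_(r, m) :=
  xget (fun=> 0) [set S | is_GCR f S].

Definition markov f (v : seq 'I_D) :
    'M[R]_(\sum_(i < D) r, \sum_(j < D) m) :=
  \mxblock_(i < D, j < D) gcr_coef f (j :: rcons v i).

(* H_f; a row (column) is given by a block row (block column) and a position
   inside it. *)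
Definition hankel f (I : nat * 'I_(\sum_(i < D) r))
    (J : nat * 'I_(\sum_(j < D) m)) : R :=
  markov f (word J.1 ++ word I.1) I.2 J.2.

End ALPV.

(* Main.v *)
(* An ALPV has the GCR S (j v i) = C_i A_v B_j, where A_v is the product of the
   matrices A_q along v.  Since P spans R^D these coefficients are those of f,
   so the entries C_i A_w A_v B_j of the Hankel matrix factor through the state
   space and its rank is at most the dimension.  Conversely, when the rank is
   finite, the column space is itself the state space of a realization: A_q
   shifts a column by the letter q, B_j gives the columns of the empty word, and
   C_i evaluates at the rows of the empty word. *)
Require Import Defs.
From mathcomp Require Import all_boot all_order all_algebra.
From mathcomp Require Import all_classical all_reals.

Set Implicit Arguments.
Unset Strict Implicit.
Unset Printing Implicit Defensive.

Import Order.TTheory GRing.Theory Num.Theory.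
Local Open Scope classical_set_scope.
Local Open Scope ring_scope.

(** * Linear spans, bases and dimension *)

Section LinearSpan.
Context {R : realType} {V : lmodType R}.
Implicit Types (S W : set V) (x y : V).

Lemma lin_span_sub S : S `<=` lin_span S.
Proof.
move=> x Sx; exists 1, (fun=> 1), (fun=> x); split=> //.
by rewrite big_ord1 scale1r.
Qed.

Lemma lin_spanS S W : S `<=` W -> lin_span S `<=` lin_span W.
Proof.
by move=> SW x [n [a [v [Sv ->]]]]; exists n, a, v; split=> // i; apply: SW.
Qed.

Lemma lin_span0 S : lin_span S 0.
Proof.
by exists 0, (fun=> 0), (fun=> 0); split=> [[]//|]; rewrite big_ord0.
Qed.

Lemma lin_spanD S x y : lin_span S x -> lin_span S y -> lin_span S (x + y).
Proof.
move=> [n1 [a1 [v1 [S1 ->]]]] [n2 [a2 [v2 [S2 ->]]]].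
exists (n1 + n2)%N,
  (fun i : 'I_(n1 + n2) =>
     match fintype.split i with inl j => a1 j | inr j => a2 j end),
  (fun i : 'I_(n1 + n2) =>
     match fintype.split i with inl j => v1 j | inr j => v2 j end).
split=> [i|]; first by case: (fintype.split i).
rewrite big_split_ord /=; congr (_ + _); apply: eq_bigr => i _.
  by rewrite (unsplitK (inl i)).
by rewrite (unsplitK (inr i)).
Qed.

Lemma lin_spanZ S (a : R) x : lin_span S x -> lin_span S (a *: x).
Proof.
move=> [n [b [v [Sv ->]]]]; exists n, (fun i => a * b i), v; split=> //.
by rewrite scaler_sumr; apply: eq_bigr => i _; rewrite scalerA.
Qed.

Lemma lin_span_comb S n (a : 'I_n -> R) (v : 'I_n -> V) :
  (forall i, lin_span S (v i)) -> lin_span S (\sum_i a i *: v i).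
Proof.
move=> Sv; apply: big_ind => [|x y|i _]; first exact: lin_span0.
  exact: lin_spanD.
exact: lin_spanZ.
Qed.

Lemma lin_span_min S W : S `<=` lin_span W -> lin_span S `<=` lin_span W.
Proof.
by move=> SW x [n [a [v [Sv ->]]]]; apply: lin_span_comb => i; apply: SW.
Qed.

Lemma lin_span_range n (e : 'I_n -> V) x :
  lin_span (range e) x -> exists a : 'I_n -> R, x = \sum_i a i *: e i.
Proof.
move=> [k [a [v [ev ->]]]].
have /boolp.choice[h hE] i : exists j, e j = v i.
  by have [j _ ej] := ev i; exists j.
(* Several [v i] may be matched with the same [e j]; their coefficients are added. *)
exists (fun j => \sum_(i | h i == j) a i).
rewrite (partition_big h predT) //=; apply: eq_bigr => j _.
by rewrite scaler_suml; apply: eq_bigr => i /eqP <-; rewrite hE.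
Qed.

(** The coordinates of the [e i] in terms of [g] form a [k] by [n] matrix whose rows are
    independent, so its rank [k] is at most [n]. *)
Lemma lin_indep_leq k n (e : 'I_k -> V) (g : 'I_n -> V) :
  lin_indep e -> (forall i, lin_span (range g) (e i)) -> (k <= n)%N.
Proof.
move=> indep_e eg.
have /boolp.choice[M eM] i := lin_span_range (eg i).
pose A : 'M[R]_(k, n) := \matrix_(i, j) M i j.
suff /eqP <- : row_free A by exact: rank_leq_col.
apply: inj_row_free => v vA; apply/rowP => i; rewrite mxE.
apply: (indep_e (v 0)); under eq_bigr do rewrite eM scaler_sumr.
rewrite exchange_big /= big1 // => j _.
under eq_bigr do rewrite scalerA.
rewrite -scaler_suml; move/rowP/(_ j): vA; rewrite !mxE => vA.
have -> : \sum_i0 v 0 i0 * M i0 j = \sum_j0 v 0 j0 * A j0 j.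
  by apply: eq_bigr => i0 _; rewrite mxE.
by rewrite vA scale0r.
Qed.

Lemma lin_indep_extend n (e : 'I_n -> V) x :
  lin_indep e -> ~ lin_span (range e) x ->
  lin_indep (fun i : 'I_n.+1 => oapp e x (unlift ord0 i)).
Proof.
move=> indep_e xNe a; rewrite big_ord_recl unlift_none /=.
under eq_bigr do rewrite liftK /=.
move=> sum0; have a0 : a ord0 = 0.
  apply/eqP/negPn/negP => a0; apply: xNe.
  have -> : x = - (a ord0)^-1 *: \sum_(i < n) a (lift ord0 i) *: e i.
    by rewrite -(addr0_eq sum0) scalerN scaleNr opprK scalerA mulVf // scale1r.
  apply: lin_spanZ; apply: lin_span_comb => i.
  by apply: lin_span_sub; exists i.
move: sum0; rewrite a0 scale0r add0r => sum0 i.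
have [j ->|->//] := unliftP ord0 i.
exact: (indep_e (fun j => a (lift ord0 j))).
Qed.

(** A largest independent family inside [S] is a basis of the span: [lin_indep_leq] bounds the sizes
    by [n], and an element of [S] outside its span would extend it. *)
Lemma basis_exists S n (g : 'I_n -> V) : S `<=` lin_span (range g) ->
  exists k, (k <= n)%N /\ exists e : 'I_k -> V, is_basis (lin_span S) e.
Proof.
move=> Sg.
pose Q k := `[< exists e : 'I_k -> V, lin_indep e /\ forall i, S (e i) >].
have Q0 : exists k, Q k.
  by exists 0%N; apply/asboolP; exists (fun=> 0); split=> [a _|]; case.
have Qn k : Q k -> (k <= n)%N.
  move=> /asboolP[e [indep_e Se]].
  by apply: lin_indep_leq indep_e _ => i; apply: Sg.
case: (ex_maxnP Q0 Qn) => k Qk k_max; exists k; split; first exact: Qn.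
have [e [indep_e Se]] := asboolP _ Qk.
exists e; split=> //; apply/seteqP; split.
  by apply: lin_spanS => _ [i _ <-].
apply: lin_span_min => x Sx; apply: contrapT => xNe.
suff /k_max : Q k.+1 by rewrite ltnn.
apply/asboolP; eexists; split; first exact: lin_indep_extend indep_e xNe.
by move=> i /=; case: unlift => [j|] /=; [exact: Se|exact: Sx].
Qed.

Lemma lin_dimE W n (e : 'I_n -> V) : is_basis W e -> lin_dim W = n%:R%:E.
Proof.
move=> [indep_e spe]; rewrite /lin_dim; case: pselect => [h|[]]; last first.
  by exists n, e.
case: cid => k /= [g [indep_g spg]]; congr (_%:R%:E)%E; apply/eqP.
rewrite eqn_leq; apply/andP; split; [apply: (lin_indep_leq indep_g (g := e))|
  apply: (lin_indep_leq indep_e (g := g))] => i.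
  by rewrite spe -spg; apply: lin_span_sub; exists i.
by rewrite spg -spe; apply: lin_span_sub; exists i.
Qed.

Lemma lin_dim_fin W : (lin_dim W < +oo)%E ->
  exists n, exists e : 'I_n -> V, is_basis W e.
Proof. by rewrite /lin_dim; case: pselect. Qed.

End LinearSpan.

(** Every column of [H] is a combination of the [n] columns of [F], with coefficients from a column
    of [G]. *)
Lemma mat_rank_factor (R : realType) (I J : Type) (H : I -> J -> R) n
    (F : I -> 'I_n -> R) (G : 'I_n -> J -> R) :
  (forall i j, H i j = \sum_s F i s * G s j) ->
  exists k, (k <= n)%N /\ mat_rank H = k%:R%:E.
Proof.
move=> HFG.
have [|k [kn [e eb]]] := @basis_exists R (I -> R^o)
    (range (fun j i => H i j)) n (fun s i => F i s).
  move=> _ [j _ <-].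
  have -> : (fun i => H i j : R^o) =
      \sum_s G s j *: (fun i => F i s : R^o).
    apply/funext => i; rewrite HFG fct_sumE; apply: eq_bigr => s _.
    by rewrite mulrC.
  by apply: lin_span_comb => s; apply: lin_span_sub; exists s.
by exists k; split=> //; rewrite /mat_rank (lin_dimE eb).
Qed.

(** * Multilinear sums over words of a fixed length *)

Section WordSum.
Context {R : realType} {D : nat}.

(** This is the sum over words in a GCR, as [wsum_tuple] shows, in a recursive form suited to
    induction on the schedule. *)
Fixpoint wsum {V : lmodType R} (ps : seq 'cV[R]_D) (T : seq 'I_D -> V) : V :=
  if ps is p :: ps' then \sum_q p q 0 *: wsum ps' (fun v => T (q :: v))
  else T [::].

Lemma eq_wsum {V : lmodType R} ps (T1 T2 : seq 'I_D -> V) :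
  (forall v, size v = size ps -> T1 v = T2 v) -> wsum ps T1 = wsum ps T2.
Proof.
elim: ps T1 T2 => [|p ps IH] T1 T2 T12 /=; first exact: T12.
apply: eq_bigr => q _; congr (_ *: _); apply: IH => v vs.
by apply: T12; rewrite /= vs.
Qed.

Lemma linear_wsum {V W : lmodType R} (g : {linear V -> W}) ps T :
  g (wsum ps T) = wsum ps (g \o T).
Proof.
elim: ps T => [//|p ps IH] T /=; rewrite linear_sum.
by apply: eq_bigr => q _; rewrite linearZ /= IH.
Qed.

Lemma wsumB {V : lmodType R} ps (T1 T2 : seq 'I_D -> V) :
  wsum ps (fun v => T1 v - T2 v) = wsum ps T1 - wsum ps T2.
Proof.
elim: ps T1 T2 => [//|p ps IH] T1 T2 /=; rewrite -sumrB.
by apply: eq_bigr => q _; rewrite IH scalerBr.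
Qed.

(** Expansion along the last letter, the direction in which the state and output equations advance
    in time. *)
Lemma wsum_rcons {V : lmodType R} ps p (T : seq 'I_D -> V) :
  wsum (rcons ps p) T = \sum_q p q 0 *: wsum ps (fun v => T (rcons v q)).
Proof.
elim: ps T => [//|p' ps IH] T /=; under eq_bigr do rewrite IH scaler_sumr.
rewrite exchange_big /=; apply: eq_bigr => q _; rewrite scaler_sumr.
by apply: eq_bigr => q' _; rewrite !scalerA mulrC.
Qed.

Lemma wsum_tuple {V : lmodType R} n (p : nat -> 'cV[R]_D) (T : seq 'I_D -> V) :
  \sum_(v : n.-tuple 'I_D) (\prod_(i < n) p i (tnth v i) 0) *: T v =
  wsum (mkseq p n) T.
Proof.
elim: n p T => [|n IH] p T.
  rewrite (big_pred1 [tuple]) => [|v]; last by apply/esym/eqP; exact: tuple0.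
  by rewrite big_ord0 scale1r.
have -> : mkseq p n.+1 = p 0%N :: mkseq (fun i => p i.+1) n.
  by rewrite /mkseq /= (iotaDl 1 0) -map_comp.
rewrite /=; under [RHS]eq_bigr do rewrite -IH scaler_sumr.
rewrite pair_big /=.
rewrite (reindex (fun qv : 'I_D * n.-tuple 'I_D => [tuple of qv.1 :: qv.2])) /=.
  apply: eq_bigr => -[q v] _ /=.
  rewrite scalerA big_ord_recl tnth0; congr (_ * _ *: _).
  by apply: eq_bigr => i _; rewrite tnthS.
exists (fun v => (thead v, [tuple of behead v])) => [[q v] _|v _] /=.
  by congr pair; apply: val_inj.
by rewrite -tuple_eta.
Qed.

Lemma wsum_comb {V : lmodType R} k (a : 'I_k -> R) ps
    (T : 'I_k -> seq 'I_D -> V) :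
  wsum ps (fun v => \sum_i a i *: T i v) = \sum_i a i *: wsum ps (T i).
Proof.
elim: ps T => [//|p ps IH] T /=.
under eq_bigr do rewrite IH scaler_sumr; rewrite exchange_big /=.
apply: eq_bigr => i _; rewrite scaler_sumr; apply: eq_bigr => q _.
by rewrite !scalerA mulrC.
Qed.

(* By multilinearity the vanishing extends from points of P to all of R^D, in
   particular to the canonical basis. *)
Lemma wsum_eq0 {V : lmodType R} (P : set 'cV[R]_D) (T : seq 'I_D -> V) n :
  lin_span P = [set: 'cV[R]_D] ->
  (forall ps : seq P, size ps = n -> wsum (map val ps) T = 0) ->
  forall v, size v = n -> T v = 0.
Proof.
move=> spanP; elim: n T => [|n IH] T T0.
  by move=> v /size0nil ->; apply: (T0 [::]).
case=> [//|q v] [vn].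
(* The first schedule value [p] is fixed and absorbed into the family, which leaves words of length
   [n]. *)
have Tp (p : P) : \sum_q val p q 0 *: T (q :: v) = 0.
  apply: (IH (fun v => \sum_q val p q 0 *: T (q :: v))) vn => ps psn.
  by have := T0 (p :: ps); rewrite /= psn wsum_comb; apply.
have [k [a [x [Px dE]]]] : lin_span P (delta_mx q 0) by rewrite spanP.
have -> : T (q :: v) = \sum_q' (delta_mx q 0 : 'cV[R]_D) q' 0 *: T (q' :: v).
  rewrite (bigD1 q) //= big1 ?addr0 => [|q' q'q]; rewrite mxE !eqxx.
    by rewrite scale1r.
  by rewrite (negPf q'q) scale0r.
rewrite dE; under eq_bigr do rewrite summxE scaler_suml.
rewrite exchange_big big1 // => i _.
under eq_bigr do rewrite mxE -scalerA.
by rewrite -scaler_sumr (Tp (SigSub (mem_set (Px i)))) scaler0.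
Qed.

End WordSum.

(** * Generalized convolution representations and their uniqueness *)

Section InputOutput.
Context {R : realType} {D m r : nat} {P : set 'cV[R]_D}.
Implicit Types (f : nonempty_seq (P * 'cV[R]_m) -> 'cV[R]_r).
Implicit Types (S : seq 'I_D -> 'M[R]_(r, m)).

Definition scheds (w : seq (P * 'cV[R]_m)) : seq 'cV[R]_D :=
  [seq val x.1 | x <- w].

Definition inputs (w : seq (P * 'cV[R]_m)) : seq 'cV[R]_m := [seq x.2 | x <- w].

Lemma is_GCRE f S : is_GCR f S <->
  forall t (w : t.+1.-tuple (P * 'cV[R]_m)), f (existT _ t w) =
    \sum_(k < t) wsum (drop k (scheds w)) S *m nth 0 (inputs w) k.
Proof.
suff E t (w : t.+1.-tuple (P * 'cV[R]_m)) :
    \sum_(k < t)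
      (\sum_(v : (t - k).+1.-tuple 'I_D) sched_prod w v *: S v) *m
      (tnth w (inord k)).2 =
    \sum_(k < t) wsum (drop k (scheds w)) S *m nth 0 (inputs w) k.
  by split=> fS t w; rewrite fS E.
have x0 := thead w.
apply: eq_bigr => k _; have kt : (k < t.+1)%N by rewrite ltnW // ltnS.
congr (_ *m _).
  rewrite (wsum_tuple _ (fun i => val (tnth w (inord (k + i))).1)).
  congr wsum; apply: (@eq_from_nth _ 0).
    by rewrite size_mkseq size_drop size_map size_tuple subSn // ltnW.
  move=> i; rewrite size_mkseq => ik; rewrite nth_mkseq // nth_drop.
  have kit : (k + i < t.+1)%N.
    by move: ik; rewrite !ltnS -(leq_add2l k) subnKC // ltnW.
  by rewrite (nth_map x0) ?size_tuple // (tnth_nth x0) inordK.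
by rewrite (nth_map x0) ?size_tuple // (tnth_nth x0) inordK.
Qed.

(** The difference of two coefficient maps, applied to a fixed input vector, has vanishing word sums
    on all schedules of a given length at least 2; [wsum_eq0] then applies. *)
Lemma GCR_unique f S1 S2 : lin_span P = [set: 'cV[R]_D] ->
  is_GCR f S1 -> is_GCR f S2 ->
  forall v, (1 < size v)%N -> S1 v = S2 v.
Proof.
move=> spanP /is_GCRE f1 /is_GCRE f2 v v1.
apply/subr0_eq/matrixP => a b; rewrite !mxE.
(* This input selects column [b] of the coefficients. *)
pose u : 'cV[R]_m := delta_mx b 0.
suff /colP/(_ a) : (S1 v - S2 v) *m u = 0 by rewrite -colE !mxE.
apply: (wsum_eq0 (T := fun v => (S1 v - S2 v) *m u) (n := size v) spanP) => //.
case=> [|p [|p' ps]] psv; try by rewrite -psv in v1.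
(* An input that vanishes after time 0 isolates the words read from time 0. *)
pose w := (p, u) :: [seq (p', 0 : 'cV[R]_m) | p' <- p' :: ps].
have sw : size w == (size ps).+2 by rewrite /= size_map.
have fE S : \sum_(k < (size ps).+1) wsum (drop k (scheds w)) S *m
    nth 0 (inputs w) k = wsum (map val (p :: p' :: ps)) (fun v => S v *m u).
  rewrite big_ord_recl big1 ?addr0 => [|i _].
    rewrite drop0 [LHS](linear_wsum (mulmxr u)).
    suff -> : scheds w = map val (p :: p' :: ps) by [].
    by rewrite /scheds /= -map_comp.
  rewrite /inputs /= -map_comp.
  case: i => -[|i] /= _; first by rewrite mulmx0.
  have [il|il] := ltnP i (size ps).
    by rewrite (nth_map p) // mulmx0.
  by rewrite nth_default ?size_map // mulmx0.
under eq_wsum => v' _ do rewrite mulmxBl.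
rewrite (wsumB _ (fun v => S1 v *m u)) -!fE.
by rewrite -(f1 _ (Tuple sw)) -(f2 _ (Tuple sw)) subrr.
Qed.

(** Since [k < t], the schedule from time [k] to [t] has at least two values, so only words of
    length greater than 1 occur. *)
Lemma eq_is_GCR f S1 S2 : (forall v, (1 < size v)%N -> S1 v = S2 v) ->
  is_GCR f S1 -> is_GCR f S2.
Proof.
move=> S12 /is_GCRE f1; apply/is_GCRE => t w; rewrite f1.
apply: eq_bigr => k _; congr (_ *m _); apply: eq_wsum => v vs.
by apply: S12; rewrite vs size_drop size_map size_tuple ltn_subRL addn1 ltnS.
Qed.

Lemma gcr_coefP f : has_GCR f -> is_GCR f (gcr_coef f).
Proof.
move=> [S fS].
by apply: (@xgetPex _ (fun=> 0) [set S | is_GCR f S]); exists S.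
Qed.

(** * The convolution coefficients of an ALPV *)

Section Coefficients.
Variable Sigma : alpv m r P.
Local Notation n := (alpv_dim Sigma).

(** The first letter acts first, so the matrices multiply [M] from the left in reading order. The
    width [k] is free so that [M] can be an input matrix or the identity. *)
Definition trans_mx (v : seq 'I_D) k (M : 'M[R]_(n, k)) : 'M[R]_(n, k) :=
  foldl (fun M q => mxA Sigma q *m M) M v.

(** The first letter injects the input, the later ones propagate it; along the empty word no input
    has entered yet. *)
Definition reach_mx (v : seq 'I_D) : 'M[R]_(n, m) :=
  if v is q :: v' then trans_mx v' (mxB Sigma q) else 0.

Definition alpv_coef (v : seq 'I_D) : 'M[R]_(r, m) :=
  if v is q :: v' then mxC Sigma (last q v') *m reach_mx (belast q v') else 0.

Lemma trans_mxM v k (M : 'M[R]_(n, k)) : trans_mx v M = trans_mx v 1%:M *m M.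
Proof.
elim/last_ind: v => [|v q IH]; first by rewrite /trans_mx /= mul1mx.
by rewrite /trans_mx !foldl_rcons -/(trans_mx _ _) IH mulmxA.
Qed.

Lemma reach_mx_rcons q v : v != [::] ->
  reach_mx (rcons v q) = mxA Sigma q *m reach_mx v.
Proof. by case: v => [//|q' v] _ /=; rewrite /trans_mx foldl_rcons. Qed.

Lemma alpv_coef_rcons q v :
  alpv_coef (rcons v q) = mxC Sigma q *m reach_mx v.
Proof.
by case: v => [|q' v] //=; rewrite last_rcons belast_rcons.
Qed.

(** Variation of constants: the state superposes the propagated effects of all past inputs. *)
Lemma stateE w : state Sigma w =
  \sum_(k < size w) wsum (drop k (scheds w)) reach_mx *m nth 0 (inputs w) k.
Proof.
elim/last_ind: w => [|w x IH]; first by rewrite big_ord0.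
rewrite /state foldl_rcons -/(state _ _) /next_state.
(* The newest input is split off: its words have a single letter and give the input term of
   [next_state]. The words of every older input gain one final letter, which contributes the factor
   [mxA Sigma q]. *)
rewrite size_rcons big_ord_recr /= /scheds /inputs !map_rcons.
rewrite drop_rcons ?size_map // nth_rcons size_map ltnn eqxx.
rewrite drop_oversize ?size_map //=.
under eq_bigr do rewrite scalerDr; rewrite big_split /=; congr (_ + _).
  under [RHS]eq_bigr => k _.
    rewrite drop_rcons ?size_map 1?ltnW // nth_rcons size_map ltn_ord.
    rewrite wsum_rcons mulmx_suml.
    under eq_bigr => q _.
      rewrite (eq_wsum (T2 := fun v => mxA Sigma q *m reach_mx v)); last first.
        move=> v vs; apply: reach_mx_rcons; rewrite -size_eq0 vs size_drop.
        by rewrite size_map -lt0n subn_gt0.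
      rewrite -(linear_wsum (mulmx (mxA Sigma q))) -scalemxAl -mulmxA.
      over.
    over.
  rewrite exchange_big /=; apply: eq_bigr => q _.
  by rewrite IH mulmx_sumr scaler_sumr.
by rewrite mulmx_suml; apply: eq_bigr => q _; rewrite scalemxAl.
Qed.

Lemma io_map_GCR : is_GCR (io_map Sigma) alpv_coef.
Proof.
apply/is_GCRE => t w; rewrite /io_map /output.
(* The last entry contributes its scheduling value only; the sum over [k < t] omits its input. *)
have wE : tval w = rcons (take t w) (tnth w ord_max).
  rewrite (tnth_nth (thead w)) -take_nth ?size_tuple //=.
  by rewrite take_oversize // size_tuple.
have st : size (take t w) = t by rewrite size_take size_tuple ltnSn.
rewrite [X in scheds X]wE [X in inputs X]wE.
move: (take t w) (tnth w ord_max) st => {wE w} w x st; rewrite stateE -{}st.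
under eq_bigr do rewrite mulmx_sumr scaler_sumr.
rewrite exchange_big /=; apply: eq_bigr => k _.
rewrite /scheds /inputs !map_rcons drop_rcons ?size_map 1?ltnW //.
rewrite nth_rcons size_map ltn_ord wsum_rcons mulmx_suml.
apply: eq_bigr => q _.
under [in RHS]eq_wsum do rewrite alpv_coef_rcons.
by rewrite -(linear_wsum (mulmx (mxC Sigma q))) -scalemxAl -mulmxA.
Qed.

(** Cutting the word between [v1] and [v2] separates what is reached through [j v1] from what is
    observed through [v2 i]. *)
Lemma alpv_coefE i j v1 v2 : alpv_coef (j :: rcons (v1 ++ v2) i) =
  mxC Sigma i *m trans_mx v2 1%:M *m trans_mx v1 (mxB Sigma j).
Proof.
rewrite -rcons_cons alpv_coef_rcons /= /trans_mx foldl_cat -!/(trans_mx _ _).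
by rewrite trans_mxM mulmxA.
Qed.

End Coefficients.

(** * The Hankel matrix: rank bound and realization *)

Lemma hankelE f k l i j a b :
  hankel f (k, tagnat.Rank i a) (l, tagnat.Rank j b) =
  gcr_coef f (j :: rcons (word l ++ word k) i) a b.
Proof.
(* [tagnat.Rank i a] is the flat index of position [a] in block [i]. *)
transitivity (submxblock (markov f (word l ++ word k)) i j a b).
  by rewrite [RHS]mxE.
by rewrite mxblockK.
Qed.

Lemma hankel_rank_le Sigma f : lin_span P = [set: 'cV[R]_D] ->
  is_realization Sigma f ->
  exists k, (k <= alpv_dim Sigma)%N /\ mat_rank (hankel f) = k%:R%:E.
Proof.
move=> spanP fE; have gcrf : is_GCR f (alpv_coef Sigma).
  by rewrite fE; apply: io_map_GCR.
(* [F] collects the rows of an infinite observability matrix, [G] the columns of an infinite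
   reachability matrix. *)
pose F (I : nat * 'I_(\sum_(i < D) r)) s : R :=
  (mxC Sigma (tagnat.sig1 I.2) *m trans_mx (word I.1) 1%:M)
    (tagnat.sig2 I.2) s.
pose G s (J : nat * 'I_(\sum_(j < D) m)) : R :=
  trans_mx (word J.1) (mxB Sigma (tagnat.sig1 J.2)) s (tagnat.sig2 J.2).
apply: (@mat_rank_factor _ _ _ _ _ F G) => -[k I] [l J].
rewrite -[in LHS](tagnat.sig2K I) -[in LHS](tagnat.sig2K J) hankelE.
have /gcr_coefP gcrf' : has_GCR f by exists (alpv_coef Sigma).
rewrite (GCR_unique spanP gcrf' gcrf) ?[size _]/= ?size_rcons //.
by rewrite alpv_coefE mxE.
Qed.

(** States are coordinate vectors, with respect to [e], of elements of the column space. *)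
Lemma hankel_realization f n
    (e : 'I_n -> (nat * 'I_(\sum_(i < D) r) -> R^o)) : (0 < D)%N ->
  has_GCR f ->
  is_basis (lin_span (range (fun J I => hankel f I J : R^o))) e ->
  exists2 Sigma : alpv m r P, alpv_dim Sigma = n & is_realization Sigma f.
Proof.
move=> D_gt0 gcrf [_ span_e].
have /boolp.choice[idx wordK] := word_onto D_gt0.
pose col J : nat * 'I_(\sum_(i < D) r) -> R^o := fun I => hankel f I J.
pose shift q (h : nat * 'I_(\sum_(i < D) r) -> R^o) :
    nat * 'I_(\sum_(i < D) r) -> R^o := fun I => h (idx (q :: word I.1), I.2).
have colE l k i a j b : col (l, tagnat.Rank j b) (k, tagnat.Rank i a) =
    gcr_coef f (j :: rcons (word l ++ word k) i) a b.
  exact: hankelE.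
have shift_comb q k (a : 'I_k -> R) h :
    shift q (\sum_i a i *: h i) = \sum_i a i *: shift q (h i).
  by apply/funext => I; rewrite /shift !fct_sumE.
(* The Hankel structure: [word l] followed by [q w] is the same word as [word l] extended by [q] and
   followed by [w]. *)
have shift_col q l J : shift q (col (l, J)) = col (idx (rcons (word l) q), J).
  apply/funext => -[k I]; rewrite /shift /=.
  by rewrite -(tagnat.sig2K I) -(tagnat.sig2K J) !colE !wordK cat_rcons.
have col_e J : exists c : 'I_n -> R, col J = \sum_s c s *: e s.
  by apply: lin_span_range; rewrite span_e; apply: lin_span_sub; exists J.
(* The column space is invariant under the shifts, so each shift has a matrix in terms of [e]. *)
have shift_e qs : exists c : 'I_n -> R,
    shift qs.1 (e qs.2) = \sum_s c s *: e s.
  case: qs => q s /=; apply: lin_span_range; rewrite span_e.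
  have : lin_span (range e) (e s) by apply: lin_span_sub; exists s.
  rewrite span_e => -[k [a [v [vcol ->]]]]; rewrite shift_comb.
  apply: lin_span_comb => i; have [[l J] _ <-] := vcol i.
  by rewrite -/(col (l, J)) shift_col; apply: lin_span_sub; eexists.
have [coord col_coord] := boolp.choice col_e.
have [shc shift_coord] := boolp.choice shift_e.
pose Sigma : alpv m r P := ALPV P
  (fun q => \matrix_(s, s') shc (q, s') s)
  (fun q => \matrix_(s, b) coord (idx [::], tagnat.Rank q b) s)
  (fun q => \matrix_(a, s) e s (idx [::], tagnat.Rank q a)).
exists Sigma => //.
(* Column [b] of [reach_mx] along [j v] represents the Hankel column of the word [v]; appending a
   letter shifts that column. *)
have reachE j v b : \sum_s reach_mx Sigma (j :: v) s b *: e s =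
    col (idx v, tagnat.Rank j b).
  elim/last_ind: v => [|v q IH].
    by rewrite col_coord; apply: eq_bigr => s _; rewrite mxE.
  rewrite -rcons_cons reach_mx_rcons // -[v in RHS]wordK -shift_col -IH.
  rewrite shift_comb.
  under [RHS]eq_bigr do rewrite (shift_coord (_, _)) scaler_sumr.
  rewrite exchange_big; apply: eq_bigr => s _.
  rewrite mxE scaler_suml; apply: eq_bigr => s' _.
  by rewrite scalerA mxE mulrC.
(* The coefficient of [j v i] is the entry of the column of [v] in the block row of the empty word,
   where the output matrix evaluates. *)
have coefE v : (1 < size v)%N -> gcr_coef f v = alpv_coef Sigma v.
  case: v => [//|j v]; case/lastP: v => [//|v i] _.
  rewrite -rcons_cons alpv_coef_rcons; apply/matrixP => a b.
  rewrite rcons_cons mxE.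
  have := colE (idx v) (idx [::]) i a j b; rewrite !wordK cats0 => <-.
  rewrite -reachE fct_sumE; apply: eq_bigr => s _.
  by rewrite mxE mulrC.
apply/funext => -[t w].
(* A GCR determines its map, and both maps have the one given by [alpv_coef Sigma]. *)
have /is_GCRE -> := eq_is_GCR coefE (gcr_coefP gcrf).
by have /is_GCRE -> := io_map_GCR Sigma.
Qed.

End InputOutput.

Theorem theorem4 (R : realType) (D m r : nat)
    (D_gt0 : (0 < D)%N) (m_gt0 : (0 < m)%N) (r_gt0 : (0 < r)%N)
    (P : set 'cV[R]_D) (spanP : lin_span P = [set: 'cV[R]_D])
    (f : nonempty_seq (P * 'cV[R]_m) -> 'cV[R]_r) :
  ((exists Sigma : alpv m r P, is_realization Sigma f) <->
    has_GCR f /\ (mat_rank (hankel f) < +oo)%E) /\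
  (forall Sigma : alpv m r P, is_minimal_realization Sigma f ->
    (alpv_dim Sigma)%:R%:E = mat_rank (hankel f)).
Proof.
have gcr_of Sigma : is_realization Sigma f -> has_GCR f.
  by move=> ->; exists (alpv_coef Sigma); apply: io_map_GCR.
(* The size of a finite basis of the column span is both the rank and the dimension of the
   realization. *)
have realize : has_GCR f -> (mat_rank (hankel f) < +oo)%E ->
    exists2 Sigma : alpv m r P, is_realization Sigma f &
      mat_rank (hankel f) = (alpv_dim Sigma)%:R%:E.
  move=> gcrf /lin_dim_fin[n [e eb]].
  have [Sigma dimE fE] := hankel_realization D_gt0 gcrf eb.
  by exists Sigma => //; rewrite dimE /mat_rank (lin_dimE eb).
split; first split=> [[Sigma fE]|[gcrf rank_fin]].
- split; first exact: gcr_of fE.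
  by have [k [_ ->]] := hankel_rank_le spanP fE; exact: ltry.
- by have [Sigma fE _] := realize gcrf rank_fin; exists Sigma.
move=> Sigma [fE Sigma_min].
have [k [k_le rankE]] := hankel_rank_le spanP fE.
(* Minimality against a realization of dimension [k] gives the upper bound on the dimension; [k_le]
   is the lower bound. *)
have [|Sigma' fE' rankE'] := realize (gcr_of _ fE); first by rewrite rankE ltry.
apply/eqP; rewrite rankE eqe eqr_nat eqn_leq k_le andbT.
move: rankE'; rewrite rankE => /eqP; rewrite eqe eqr_nat => /eqP ->.
exact: Sigma_min.
Qed.
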